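(* If $\mathcal{G}$ is provable in $\mathsf{LNGL}$, then $\mathcal{G}$ is valid.
   Context: Formulae are built from propositional atoms $p$ by $\neg$, $\lor$, $\Box$; a formula is valid iff it holds at every world of every Kripke model whose accessibility relation is transitive and conversely wellfounded (Gödel–Löb logic $\mathsf{GL}$). A linear nested sequent is an expression $\mathcal{G} = \Gamma_{1} \vdash \Delta_{1} \mathbin{/\!/} \cdots \mathbin{/\!/} \Gamma_{n} \vdash \Delta_{n}$ with $\Gamma_i,\Delta_i$ finite multisets of formulae. Its formula interpretation is $f(\Gamma \vdash \Delta) := \bigwedge \Gamma \rightarrow \bigvee \Delta$ and $f(\Gamma \vdash \Delta \mathbin{/\!/} \mathcal{G}) := \bigwedge \Gamma \rightarrow (\bigvee \Delta \lor \Box f(\mathcal{G}))$; $\mathcal{G}$ is valid iff $f(\mathcal{G})$ is valid. The calculus $\mathsf{LNGL}$ has the following rules, where $\mathcal{G}$ denotes a (possibly empty) initial segment of a linear nested sequent: initial sequents $\mathsf{id_1}$: $\mathcal{G} \mathbin{/\!/} \Gamma, p \vdash p, \Delta$ and $\mathsf{id_2}$: $\mathcal{G} \mathbin{/\!/} \Gamma, \Box\phi \vdash \Box\phi, \Delta$; $\lor\mathsf{L}$: from $\mathcal{G} \mathbin{/\!/} \Gamma, \phi \vdash \Delta$ and $\mathcal{G} \mathbin{/\!/} \Gamma, \psi \vdash \Delta$ infer $\mathcal{G} \mathbin{/\!/} \Gamma, \phi\lor\psi \vdash \Delta$; $\lor\mathsf{R}$: from $\mathcal{G} \mathbin{/\!/}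 \Gamma \vdash \phi,\psi,\Delta$ infer $\mathcal{G} \mathbin{/\!/} \Gamma \vdash \phi\lor\psi,\Delta$; $\neg\mathsf{L}$: from $\mathcal{G} \mathbin{/\!/} \Gamma \vdash \phi,\Delta$ infer $\mathcal{G} \mathbin{/\!/} \Gamma,\neg\phi \vdash \Delta$; $\neg\mathsf{R}$: from $\mathcal{G} \mathbin{/\!/} \Gamma,\phi \vdash \Delta$ infer $\mathcal{G} \mathbin{/\!/} \Gamma \vdash \neg\phi,\Delta$; $\mathsf{4L}$: from $\mathcal{G} \mathbin{/\!/} \Gamma,\Box\phi \vdash \Delta \mathbin{/\!/} \Sigma,\Box\phi \vdash \Pi$ infer $\mathcal{G} \mathbin{/\!/} \Gamma,\Box\phi \vdash \Delta \mathbin{/\!/} \Sigma \vdash \Pi$; $\Box\mathsf{L}$: from $\mathcal{G} \mathbin{/\!/} \Gamma,\Box\phi \vdash \Delta \mathbin{/\!/} \Sigma,\phi \vdash \Pi$ infer $\mathcal{G} \mathbin{/\!/} \Gamma,\Box\phi \vdash \Delta \mathbin{/\!/} \Sigma \vdash \Pi$; $\Box\mathsf{R}$: from $\mathcal{G} \mathbin{/\!/} \Gamma \vdash \Delta \mathbin{/\!/} \Box\phi \vdash \phi$ infer $\mathcal{G} \mathbin{/\!/} \Gamma \vdash \Box\phi,\Delta$. *)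

(* Defs.v *)
From HB Require Import structures.
From mathcomp Require Import all_boot.
From mathcomp Require Import finmap multiset.

Set Implicit Arguments.
Unset Strict Implicit.
Unset Printing Implicit Defensive.

Declare Scope gl_scope.
Delimit Scope gl_scope with gl.
Local Open Scope mset_scope.

Inductive form : Type :=
| Atom of nat
| Neg of form
| Or of form & form
| Box of form.

(* Finite multisets {mset form} need a choiceType on formulae; it is transported
   from mathcomp's generic trees. *)
Fixpoint tree_of_form (a : form) : GenTree.tree nat :=
  match a with
  | Atom p => GenTree.Leaf p
  | Neg b => GenTree.Node 0 [:: tree_of_form b]
  | Or b c => GenTree.Node 1 [:: tree_of_form b; tree_of_form c]
  | Box b => GenTree.Node 2 [:: tree_of_form b]
  end.

Fixpoint form_of_tree (t : GenTree.tree nat) : option form :=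
  match t with
  | GenTree.Leaf p => Some (Atom p)
  | GenTree.Node 0 [:: t1] => omap Neg (form_of_tree t1)
  | GenTree.Node 1 [:: t1; t2] =>
      if form_of_tree t1 is Some a then omap (Or a) (form_of_tree t2) else None
  | GenTree.Node 2 [:: t1] => omap Box (form_of_tree t1)
  | _ => None
  end.

Lemma tree_of_formK : pcancel tree_of_form form_of_tree.
Proof. by elim=> [p|a /= ->|a /= -> b /= ->|a /= ->]. Qed.

HB.instance Definition _ := Countable.copy form (pcan_type tree_of_formK).

Definition Imp (a b : form) : form := Or (Neg a) b.
Definition And (a b : form) : form := Neg (Or (Neg a) (Neg b)).
Definition Top : form := Or (Atom 0) (Neg (Atom 0)).
Definition Bot : form := Neg Top.

Definition bigAnd (s : seq form) : form := foldr And Top s.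
Definition bigOr (s : seq form) : form := foldr Or Bot s.

Record model : Type := Model {
  world : Type;
  acc : world -> world -> Prop;
  val_atom : nat -> world -> Prop
}.

Fixpoint holds (M : model) (w : world M) (a : form) : Prop :=
  match a with
  | Atom p => val_atom p w
  | Neg b => ~ holds w b
  | Or b c => holds w b \/ holds w c
  | Box b => forall v : world M, acc w v -> holds v b
  end.

Definition transitive_model (M : model) : Prop :=
  forall u v w : world M, acc u v -> acc v w -> acc u w.

Definition conversely_wellfounded (M : model) : Prop :=
  well_founded (fun v w : world M => acc w v).

Definition valid (a : form) : Prop :=
  forall M : model, transitive_model M -> conversely_wellfounded M ->
  forall w : world M, holds w a.

Record sequent : Type := Sequent {
  ante : {mset form};
  succ : {mset form}
}.

Notation "G ⊢ D" := (Sequent G%mset D%mset) (at level 80, no associativity) : gl_scope.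

Inductive lns : Type :=
| LOne of sequent
| LCons of sequent & lns.

(* [G // H] for a possibly empty initial segment G, given as the list of its
   components. *)
Definition after (G : seq sequent) (H : lns) : lns := foldr LCons H G.

Fixpoint interp (G : lns) : form :=
  match G with
  | LOne s => Imp (bigAnd (ante s)) (bigOr (succ s))
  | LCons s H => Imp (bigAnd (ante s)) (Or (bigOr (succ s)) (Box (interp H)))
  end.

Definition lns_valid (G : lns) : Prop := valid (interp G).

Local Open Scope gl_scope.

Implicit Types (G : seq sequent) (Ga De Si Pi : {mset form}) (a b : form).

Inductive LNGL : lns -> Prop :=
| id1 G Ga De p :
    LNGL (after G (LOne (Atom p +` Ga ⊢ Atom p +` De)))
| id2 G Ga De a :
    LNGL (after G (LOne (Box a +` Ga ⊢ Box a +` De)))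
| orL G Ga De a b :
    LNGL (after G (LOne (a +` Ga ⊢ De))) ->
    LNGL (after G (LOne (b +` Ga ⊢ De))) ->
    LNGL (after G (LOne (Or a b +` Ga ⊢ De)))
| orR G Ga De a b :
    LNGL (after G (LOne (Ga ⊢ a +` (b +` De)))) ->
    LNGL (after G (LOne (Ga ⊢ Or a b +` De)))
| negL G Ga De a :
    LNGL (after G (LOne (Ga ⊢ a +` De))) ->
    LNGL (after G (LOne (Neg a +` Ga ⊢ De)))
| negR G Ga De a :
    LNGL (after G (LOne (a +` Ga ⊢ De))) ->
    LNGL (after G (LOne (Ga ⊢ Neg a +` De)))
| fourL G Ga De Si Pi a :
    LNGL (after G (LCons (Box a +` Ga ⊢ De) (LOne (Box a +` Si ⊢ Pi)))) ->
    LNGL (after G (LCons (Box a +` Ga ⊢ De) (LOne (Si ⊢ Pi))))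
| boxL G Ga De Si Pi a :
    LNGL (after G (LCons (Box a +` Ga ⊢ De) (LOne (a +` Si ⊢ Pi)))) ->
    LNGL (after G (LCons (Box a +` Ga ⊢ De) (LOne (Si ⊢ Pi))))
| boxR G Ga De a :
    LNGL (after G (LCons (Ga ⊢ De) (LOne ([mset Box a] ⊢ [mset a])))) ->
    LNGL (after G (LOne (Ga ⊢ Box a +` De))).

(* Main.v *)
From Stdlib Require Import Classical.
From mathcomp Require Import all_boot.
From mathcomp Require Import finmap multiset.
Require Import Defs.

(* Fix a transitive, conversely wellfounded model. A linear nested sequent
   G // H holds at w iff H holds at the end of every accessibility path from w
   that falsifies the components of G one after the other. Soundness of a rule
   thus reduces to its last one or two components, read at a single world.
   There the rules 4L and BoxL are the validity of Box a -> Box (Box a) and of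
   Box a -> Box a, while BoxR is Löb's axiom. *)

Set Implicit Arguments.
Unset Strict Implicit.
Unset Printing Implicit Defensive.

Local Open Scope mset_scope.
Local Open Scope gl_scope.

Section Semantics.

Variable M : model.

Implicit Types (u v w : world M) (a b : form) (A B C D : {mset form}).
Implicit Types (s : sequent) (G : seq sequent) (H : lns).

Definition holds_all (T : predType form) w (X : T) : Prop :=
  forall a, a \in X -> holds w a.

Definition holds_some (T : predType form) w (X : T) : Prop :=
  exists2 a, a \in X & holds w a.

Definition holds_sequent w s : Prop :=
  holds_all w (ante s) -> holds_some w (succ s).

Fixpoint holds_lns w H : Prop :=
  match H with
  | LOne s => holds_sequent w s
  | LCons s K => holds_sequent w s \/ forall v, acc w v -> holds_lns v K
  end.

Fixpoint falsifying_path G w v : Prop :=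
  if G is s :: G' then
    ~ holds_sequent w s /\ exists2 u, acc w u & falsifying_path G' u v
  else w = v.

Lemma holds_all_cons w a (X : seq form) :
  holds_all w (a :: X) <-> holds w a /\ holds_all w X.
Proof.
split=> [wX|[wa wX] b]; last by rewrite inE => /predU1P[->|/wX].
by split=> [|b Xb]; apply: wX; rewrite inE ?eqxx ?Xb ?orbT.
Qed.

Lemma holds_some_cons w a (X : seq form) :
  holds_some w (a :: X) <-> holds w a \/ holds_some w X.
Proof.
split=> [[b]|[wa|[b Xb wb]]].
- by rewrite inE => /predU1P[->|Xb]; [left | right; exists b].
- by exists a; rewrite ?mem_head.
- by exists b; rewrite // inE Xb orbT.
Qed.

Lemma holds_all_mset1D w a A :
  holds_all w (a +` A) <-> holds w a /\ holds_all w A.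
Proof.
rewrite -holds_all_cons.
by split=> wA b bA; apply: wA; move: bA; rewrite in_mset1D inE.
Qed.

Lemma holds_some_mset1D w a A :
  holds_some w (a +` A) <-> holds w a \/ holds_some w A.
Proof.
rewrite -holds_some_cons.
by split=> -[b bA wb]; exists b => //; move: bA; rewrite in_mset1D inE.
Qed.

Lemma holds_all_mset1 w a : holds_all w [mset a] <-> holds w a.
Proof.
split=> [|wa b]; first by apply; rewrite in_mset1.
by rewrite in_mset1 => /eqP->.
Qed.

Lemma holds_some_mset1 w a : holds_some w [mset a] <-> holds w a.
Proof.
split=> [[b]|wa]; first by rewrite in_mset1 => /eqP->.
by exists a; rewrite ?in_mset1.
Qed.

Lemma holds_Imp w a b : holds w (Imp a b) <-> (holds w a -> holds w b).
Proof. by have := classic (holds w a); rewrite /=; tauto. Qed.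

Lemma holds_And w a b : holds w (And a b) <-> holds w a /\ holds w b.
Proof.
by have := classic (holds w a); have := classic (holds w b); rewrite /=; tauto.
Qed.

Lemma holds_Top w : holds w Top.
Proof. exact: classic. Qed.

Lemma holds_bigAnd w (X : seq form) : holds w (bigAnd X) <-> holds_all w X.
Proof.
elim: X => [|a X IHX]; first by split=> // _; apply: holds_Top.
by rewrite [bigAnd _]/= holds_And IHX holds_all_cons.
Qed.

Lemma holds_bigOr w (X : seq form) : holds w (bigOr X) <-> holds_some w X.
Proof.
elim: X => [|a X IHX]; first by split=> [/(_ (holds_Top w))|[]].
by rewrite holds_some_cons -IHX.
Qed.

Lemma holds_interp w H : holds w (interp H) <-> holds_lns w H.
Proof.
elim: H w => [s|s H IHH] w; rewrite [interp _]/= holds_Imp holds_bigAnd.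
  by rewrite holds_bigOr.
rewrite [holds _ _]/= holds_bigOr.
have IHbox : (forall v, acc w v -> holds v (interp H)) <->
             (forall v, acc w v -> holds_lns v H).
  by split=> wH v /wH /IHH.
rewrite IHbox /= /holds_sequent.
by have := classic (holds_all w (ante s)); tauto.
Qed.

Lemma holds_after w G H :
  holds_lns w (after G H) <->
  forall v, falsifying_path G w v -> holds_lns v H.
Proof.
elim: G w => [|s G IHG] w /=; first by split=> [wH v <-|]; last exact.
split=> [[ws|wGH] v [nws [u wu Guv]] //|wGH].
  by apply: (IHG u).1 Guv; apply: wGH.
have [ws|nws] := classic (holds_sequent w s); [by left | right=> u wu].
by apply/IHG => v Guv; apply: wGH; split=> //; exists u.
Qed.

Lemma holds_sequent_id w a A B : holds_sequent w (a +` A ⊢ a +` B).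
Proof. by move=> /holds_all_mset1D[wa _]; apply/holds_some_mset1D; left. Qed.

Lemma holds_sequent_orL w a b A B :
  holds_sequent w (Or a b +` A ⊢ B) <->
  holds_sequent w (a +` A ⊢ B) /\ holds_sequent w (b +` A ⊢ B).
Proof. by rewrite /holds_sequent !holds_all_mset1D /=; tauto. Qed.

Lemma holds_sequent_orR w a b A B :
  holds_sequent w (A ⊢ Or a b +` B) <-> holds_sequent w (A ⊢ a +` (b +` B)).
Proof. by rewrite /holds_sequent !holds_some_mset1D /=; tauto. Qed.

Lemma holds_sequent_negL w a A B :
  holds_sequent w (Neg a +` A ⊢ B) <-> holds_sequent w (A ⊢ a +` B).
Proof.
rewrite /holds_sequent holds_all_mset1D holds_some_mset1D /=.
by have := classic (holds w a); tauto.
Qed.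

Lemma holds_sequent_negR w a A B :
  holds_sequent w (A ⊢ Neg a +` B) <-> holds_sequent w (a +` A ⊢ B).
Proof.
rewrite /holds_sequent holds_all_mset1D holds_some_mset1D /=.
by have := classic (holds w a); tauto.
Qed.

Lemma holds_lns_cut_Box w a s C D :
    (holds_all w (ante s) -> holds w (Box a)) ->
    holds_lns w (LCons s (LOne (a +` C ⊢ D))) ->
  holds_lns w (LCons s (LOne (C ⊢ D))).
Proof.
move=> wbox [ws|wCD]; first by left.
have [wante|nwante] := classic (holds_all w (ante s)); last by left.
right=> v wv vC; apply: (wCD v wv); apply/holds_all_mset1D.
by split=> //; apply: wbox.
Qed.

Hypothesis accT : transitive_model M.

Lemma holds_Box4 w a : holds w (Box a) -> holds w (Box (Box a)).
Proof. by move=> wa v wv u vu; apply: wa (accT wv vu). Qed.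

Hypothesis accWF : conversely_wellfounded M.

Lemma holds_Loeb w a : holds w (Box (Imp (Box a) a)) -> holds w (Box a).
Proof.
move=> wLoeb v; elim/(well_founded_ind accWF): v => v IHv wv.
have va : holds v (Box a) -> holds v a by rewrite -holds_Imp; apply: wLoeb.
by apply: va => u vu; apply: IHv vu (accT wv vu).
Qed.

Lemma holds_sequent_boxR w a A B :
    holds_lns w (LCons (A ⊢ B) (LOne ([mset Box a] ⊢ [mset a]))) ->
  holds_sequent w (A ⊢ Box a +` B).
Proof.
move=> [wAB|wa] wA; apply/holds_some_mset1D; [by right; apply: wAB | left].
apply: holds_Loeb => v /wa va; rewrite -/(holds v (Imp _ _)) holds_Imp.
by move=> /holds_all_mset1 /va /holds_some_mset1.
Qed.

Lemma LNGL_holds H : LNGL H -> forall w, holds_lns w H.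
Proof.
have path_end w v G : falsifying_path G w v ->
    forall K, (forall u, holds_lns u (after G K)) -> holds_lns v K.
  by move=> Gwv K /(_ w)/holds_after; apply.
elim=> {H} [G A B p|G A B a|G A B a b _ IHa _ IHb|G A B a b _ IH|G A B a _ IH
           |G A B a _ IH|G A B C D a _ IH|G A B C D a _ IH|G A B a _ IH] w;
  apply/holds_after => v /path_end Gv.
- exact: holds_sequent_id.
- exact: holds_sequent_id.
- by apply/holds_sequent_orL; split; [apply: Gv IHa | apply: Gv IHb].
- exact/holds_sequent_orR/(Gv _ IH).
- exact/holds_sequent_negL/(Gv _ IH).
- exact/holds_sequent_negR/(Gv _ IH).
- by apply: holds_lns_cut_Box (Gv _ IH) => /holds_all_mset1D[/holds_Box4].
- by apply: holds_lns_cut_Box (Gv _ IH) => /holds_all_mset1D[].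
- exact/holds_sequent_boxR/(Gv _ IH).
Qed.

End Semantics.

Theorem theorem4p1 (G : lns) : LNGL G -> lns_valid G.
Proof. by move=> dG M accT accWF w; apply/holds_interp/LNGL_holds. Qed.
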